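(* Let $r$ be a real number and $A,B\subseteq\omega$. Then $A\oplus B$ has intrinsic density $r$ if and only if both $A$ and $B$ have intrinsic density $r$.
   Context: $A\oplus B=\{2n:n\in A\}\cup\{2n+1:n\in B\}$. For $S\subseteq\omega$, $\rho_n(S)=|S\cap\{0,\dots,n-1\}|/n$ and $\rho(S)=\lim_n\rho_n(S)$ when it exists. $S$ has intrinsic density $r$ (written $P(S)=r$) if $\rho(\pi(S))=r$ for every computable permutation $\pi$ of $\omega$. *)

(* Defs.v *)
From mathcomp Require Import all_boot all_order all_algebra.
From mathcomp Require Import all_classical all_reals all_analysis.

Set Implicit Arguments.
Unset Strict Implicit.
Unset Printing Implicit Defensive.

Import Order.TTheory GRing.Theory Num.Theory.
Import numFieldNormedType.Exports.

Local Open Scope classical_set_scope.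

(* Kleene's partial recursive functions: [recf n] is the type of programs of
   arity n. *)
Inductive recf : nat -> Type :=
| RZero : recf 0
| RSucc : recf 1
| RProj n (i : 'I_n) : recf n
| RComp m n (f : recf m) (gs : 'I_m -> recf n) : recf n
| RPrec n (f : recf n) (g : recf n.+2) : recf n.+1
| RMu n (f : recf n.+1) : recf n.

(* Given the graphs of f and g, the graph of h at fixed parameters v, where
   h 0 v = f v and h k.+1 v = g k (h k v) v. *)
Fixpoint prec_graph n (F : n.-tuple nat -> nat -> Prop)
    (G : n.+2.-tuple nat -> nat -> Prop) (v : n.-tuple nat) (k y : nat) : Prop :=
  match k with
  | 0 => F v y
  | k'.+1 => exists2 z, prec_graph F G v k' z & G [tuple of k' :: z :: v] y
  end.

(* [reval e v y]: the program e on input v halts with output y. In the RMu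
   case all values below the least zero are required to be defined. *)
Fixpoint reval n (e : recf n) : n.-tuple nat -> nat -> Prop :=
  match e in recf n return n.-tuple nat -> nat -> Prop with
  | RZero => fun _ y => y = 0
  | RSucc => fun v y => y = (thead v).+1
  | RProj _ i => fun v y => y = tnth v i
  | RComp m _ f gs => fun v y =>
      exists2 w : m.-tuple nat,
        forall i, reval (gs i) v (tnth w i) & reval f w y
  | RPrec _ f g => fun v y =>
      prec_graph (reval f) (reval g) [tuple of behead v] (thead v) y
  | RMu _ f => fun v y =>
      reval f [tuple of y :: v] 0 /\
      forall k, k < y -> exists z, reval f [tuple of k :: v] z.+1
  end.

Definition computable (f : nat -> nat) : Prop :=
  exists e : recf 1, forall x, reval e [tuple x] (f x).

Definition computable_permutation (p : nat -> nat) : Prop :=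
  computable p /\ bijective p.

Definition set_oplus (A B : set nat) : set nat :=
  [set 2 * n | n in A] `|` [set 2 * n + 1 | n in B].

Local Open Scope ring_scope.

Definition partial_density (R : realType) (S : set nat) (n : nat) : R :=
  #|[set k : 'I_n | (k : nat) \in S]%SET|%:R / n%:R.

Definition has_density (R : realType) (S : set nat) (r : R) : Prop :=
  partial_density R S n @[n --> \oo] --> r.

Definition has_intrinsic_density (R : realType) (S : set nat) (r : R) : Prop :=
  forall p : nat -> nat, computable_permutation p -> has_density (p @` S) r.

(* Main.v *)
(* Let omega be split into the ranges of two computable injections f and g
   (here 2n and 2n+1); we show that C has intrinsic density r iff both pullbacks
   f^-1(C) and g^-1(C) do.

   Replacing each f(n) by its rank in range f identifies the density of C
   relative to range f with the density of a set computably permuting f^-1(C).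
   If both pullbacks have intrinsic density r, then under any computable
   permutation C has density r relative to both pieces, hence density r.
   Conversely, given a computable permutation q, choose a computable
   permutation p that spreads range f, in the order prescribed by q, over a
   computable set of density 1.  That p(C) has density r, relative to this set
   as well as absolutely, says exactly that q(f^-1(C)) has density r. *)

Require Import Defs.
From mathcomp Require Import all_boot all_order all_algebra.
From mathcomp Require Import all_classical all_reals all_analysis.
From mathcomp Require Import zify.

Set Implicit Arguments.
Unset Strict Implicit.
Unset Printing Implicit Defensive.

Import Order.TTheory GRing.Theory Num.Theory.
Import numFieldNormedType.Exports.

Local Open Scope classical_set_scope.

(** * Images and bijections *)

Lemma image_comp_preimage aT bT cT (f : aT -> bT) (p : bT -> cT) (C : set bT) :
  injective p -> (p \o f) @^-1` (p @` C) = f @^-1` C.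
Proof. by move=> inj_p; apply/funext => x; exact: image_inj. Qed.

Lemma image_setC_bij aT rT (p : aT -> rT) (S : set aT) :
  bijective p -> p @` (~` S) = ~` (p @` S).
Proof.
move=> [p' pK p'K]; have inj_p := can_inj pK.
apply/seteqP; split=> [_ [x NSx <-] [z Sz /inj_p zx]|y NSy].
  by apply: NSx; rewrite -zx.
by exists (p' y) => // Sy; apply: NSy; exists (p' y).
Qed.

Lemma set_bij_range T1 T2 (f : T1 -> T2) :
  injective f -> set_bij setT (range f) f.
Proof. by move=> inj_f; apply: inj_bij => ? ? _ _ /inj_f. Qed.

Lemma set_bij_glue T1 T2 (S : set T1) (D : set T2) (u v : T1 -> T2) :
  set_bij S D u -> set_bij (~` S) (~` D) v ->
  bijective (fun x => if x \in S then u x else v x).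
Proof.
move=> [uSD inj_u surj_u] [vSD inj_v surj_v]; rewrite -setTT_bijective.
have uNv x y : x \in S -> y \notin S -> u x <> v y.
  move=> /set_mem/uSD Du; rewrite -in_setC => /set_mem/vSD + uv.
  by rewrite -uv; apply.
split=> //.
  move=> x y _ _; case: ifPn => Sx; case: ifPn => Sy.
  - exact: inj_u.
  - by move/(uNv _ _ Sx Sy).
  - by move/esym/(uNv _ _ Sy Sx).
  - by apply: inj_v; rewrite in_setC.
move=> z _; have [/surj_u[x Sx <-]|/surj_v[x Sx <-]] := pselect (D z).
  by exists x; rewrite // mem_set.
by exists x; rewrite // memNset.
Qed.

(** * Computable functions and sets *)

Definition recursive n (F : seq nat -> nat) : Prop :=
  exists e : recf n, forall v : n.-tuple nat, reval e v (F v).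

Definition computable2 (f : nat -> nat -> nat) : Prop :=
  recursive 2 (fun v => f (nth 0 v 0) (nth 0 v 1)).

Definition computable3 (f : nat -> nat -> nat -> nat) : Prop :=
  recursive 3 (fun v => f (nth 0 v 0) (nth 0 v 1) (nth 0 v 2)).

Definition computable_injection (f : nat -> nat) : Prop :=
  computable f /\ injective f.

Definition computable_set (S : set nat) : Prop :=
  computable (fun n => n \in S).

Lemma eq_recursive n (F G : seq nat -> nat) :
  (forall v, size v = n -> F v = G v) -> recursive n F -> recursive n G.
Proof.
move=> FG [e He]; exists e => v.
by rewrite -FG ?size_tuple//; exact: He.
Qed.

Lemma computableP f : computable f <-> recursive 1 (fun v => f (nth 0 v 0)).
Proof.
split=> -[e He]; exists e; last by move=> x; exact: (He [tuple x]).
move=> v; suff -> : v = [tuple nth 0 v 0] by exact: He.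
by apply: val_inj; case: v => [[|x []]].
Qed.

Lemma recursive_nth n i : i < n -> recursive n (fun v => nth 0 v i).
Proof.
by move=> lt_in; exists (RProj (Ordinal lt_in)) => v /=; rewrite (tnth_nth 0).
Qed.

Lemma recursive_comp n f G :
  computable f -> recursive n G -> recursive n (fun v => f (G v)).
Proof.
move=> [e He] [e1 He1]; exists (RComp e (fun=> e1)) => v /=.
exists [tuple G v]; last exact: He.
by case=> [[|//] ?]; rewrite (tnth_nth 0) /=.
Qed.

Lemma recursive_comp2 n f G H :
  computable2 f -> recursive n G -> recursive n H ->
  recursive n (fun v => f (G v) (H v)).
Proof.
move=> [e He] [e1 He1] [e2 He2].
exists (RComp e (fun i => if i == ord0 then e1 else e2)) => v /=.
exists [tuple G v; H v]; last exact: (He [tuple G v; H v]).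
by case=> [[|[|//]] ?]; rewrite (tnth_nth 0) /=.
Qed.

Lemma recursive_prec n (F G : seq nat -> nat) (H : nat -> seq nat -> nat) :
  recursive n F -> recursive n.+2 G ->
  (forall v, H 0 v = F v) ->
  (forall k v, H k.+1 v = G [:: k, H k v & v]) ->
  recursive n.+1 (fun v => H (head 0 v) (behead v)).
Proof.
move=> [e He] [e' He'] H0 HS; exists (RPrec e e') => v /=.
rewrite /thead (tnth_nth 0) nth0; elim: (head 0 v) => [|k IH] /=.
  by rewrite H0; exact: (He [tuple of behead v]).
exists (H k (behead v)) => //.
by rewrite HS; exact: (He' [tuple of [:: k, H k (behead v) & behead v]]).
Qed.

Lemma recursive_mu n (F : seq nat -> nat) (H : seq nat -> nat) :
  recursive n.+1 F -> (forall v, F (H v :: v) = 0) ->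
  (forall v k, k < H v -> 0 < F (k :: v)) -> recursive n H.
Proof.
move=> [e He] F0 Fpos; exists (RMu e) => v /=; split.
  by have := He [tuple of H v :: v]; rewrite /= F0.
move=> k /Fpos Fk; exists (F (k :: v)).-1.
by rewrite prednK//; exact: (He [tuple of k :: v]).
Qed.

Lemma computable_succ : computable succn.
Proof. by exists RSucc. Qed.

Lemma recursive_const n c : recursive n (fun=> c).
Proof.
elim: c => [|c /(recursive_comp computable_succ)//].
have gs (i : 'I_0) : recf n by case: i.
by exists (RComp RZero gs) => v /=; exists [tuple] => // -[].
Qed.

Lemma computable_prec c (g : nat -> nat -> nat) (h : nat -> nat) :
  computable2 g -> h 0 = c -> (forall k, h k.+1 = g k (h k)) -> computable h.
Proof.
move=> cg h0 hS; apply/computableP.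
have := @recursive_prec 0 (fun=> c) (fun v => g (nth 0 v 0) (nth 0 v 1))
  (fun k _ => h k) (recursive_const 0 c) cg (fun=> h0) (fun k _ => hS k).
by apply: eq_recursive => v _; rewrite nth0.
Qed.

Lemma computable2_prec (f : nat -> nat) (g : nat -> nat -> nat -> nat)
    (h : nat -> nat -> nat) :
  computable f -> computable3 g -> (forall x, h 0 x = f x) ->
  (forall k x, h k.+1 x = g k (h k x) x) -> computable2 h.
Proof.
move=> /computableP cf cg h0 hS.
have := @recursive_prec 1 (fun v => f (nth 0 v 0))
  (fun v => g (nth 0 v 0) (nth 0 v 1) (nth 0 v 2))
  (fun k v => h k (nth 0 v 0)) cf cg (fun v => h0 _) (fun k v => hS k _).
by apply: eq_recursive => -[|x []].
Qed.

Lemma computable_mu (f : nat -> nat -> nat) (h : nat -> nat) :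
  computable2 f -> (forall x, f (h x) x = 0) ->
  (forall x k, k < h x -> 0 < f k x) -> computable h.
Proof.
move=> cf f0 fpos; apply/computableP.
by apply: (recursive_mu cf) => [v|v k]; [exact: f0|exact: fpos].
Qed.

Lemma computable_id : computable id.
Proof. exact/computableP/recursive_nth. Qed.

Lemma computable_const c : computable (fun=> c).
Proof. exact/computableP/recursive_const. Qed.

Lemma computable_comp f g :
  computable f -> computable g -> computable (fun x => f (g x)).
Proof. by move=> cf /computableP cg; exact/computableP/(recursive_comp cf). Qed.

Lemma computable_comp2 h f g : computable2 h ->
  computable f -> computable g -> computable (fun x => h (f x) (g x)).
Proof.
move=> ch /computableP cf /computableP cg.
exact/computableP/(recursive_comp2 ch).
Qed.

Lemma computable2_swap f : computable2 f -> computable2 (fun x y => f y x).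
Proof. by move=> cf; apply: (recursive_comp2 cf); exact: recursive_nth. Qed.

Lemma computable2_add : computable2 addn.
Proof.
apply: (@computable2_prec id (fun _ y _ => y.+1)) => //.
- exact: computable_id.
- exact/(recursive_comp computable_succ)/recursive_nth.
Qed.

Lemma computable2_mul : computable2 muln.
Proof.
apply: (@computable2_prec (fun=> 0) (fun _ y x => x + y)) => //.
- exact: computable_const.
- by apply: (recursive_comp2 computable2_add); exact: recursive_nth.
Qed.

Lemma computable_pred : computable predn.
Proof.
by apply: (@computable_prec 0 (fun k _ => k)) => //; exact: recursive_nth.
Qed.

Lemma computable2_sub : computable2 subn.
Proof.
apply/(@computable2_swap (fun x y => y - x)).
apply: (@computable2_prec id (fun _ y _ => y.-1)) => [||x|k x].
- exact: computable_id.
- exact/(recursive_comp computable_pred)/recursive_nth.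
- exact: subn0.
- exact: subnS.
Qed.

Lemma computable_setC S : computable_set S -> computable_set (~` S).
Proof.
move=> cS; rewrite /computable_set.
have -> : (fun n => n \in ~` S : nat) = (fun n => 1 - (n \in S)).
  by apply/funext => n; rewrite in_setC; case: (n \in S).
exact: computable_comp2 computable2_sub (computable_const 1) cS.
Qed.

Lemma computable_if S f g : computable_set S -> computable f -> computable g ->
  computable (fun n => if n \in S then f n else g n).
Proof.
move=> cS cf cg.
have -> : (fun n => if n \in S then f n else g n) =
    (fun n => (n \in S) * f n + (n \in ~` S) * g n).
  apply/funext => n; rewrite in_setC.
  by case: (n \in S); rewrite mul1n mul0n ?addn0.
apply: (computable_comp2 computable2_add).
  exact: computable_comp2 computable2_mul cS cf.
exact: computable_comp2 computable2_mul (computable_setC cS) cg.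
Qed.

Lemma computable_inverse (f g : nat -> nat) :
  computable f -> cancel f g -> cancel g f -> computable g.
Proof.
move=> cf fK gK.
apply: (@computable_mu (fun k x => (f k - x) + (x - f k))) => [|x|x k lt_kg].
- apply: (recursive_comp2 computable2_add);
    apply: (recursive_comp2 computable2_sub);
    by [exact: recursive_nth | exact/(recursive_comp cf)/recursive_nth].
- by rewrite gK; lia.
- have : f k <> x by move=> fkx; rewrite -fkx fK ltnn in lt_kg.
  by lia.
Qed.

Lemma computable_permutation_inverse p : computable_permutation p ->
  exists p', [/\ computable_permutation p', cancel p p' & cancel p' p].
Proof.
move=> [cp [p' pK p'K]]; exists p'; split=> //.
by split; [exact: computable_inverse cp pK p'K|exists p].
Qed.

Lemma computable_set_image p S :
  computable_permutation p -> computable_set S -> computable_set (p @` S).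
Proof.
move=> /computable_permutation_inverse[p' [[cp' _] pK p'K]] cS.
rewrite /computable_set (_ : (fun n => _) = (fun n => p' n \in S : nat)).
  exact: computable_comp cS cp'.
by apply/funext => n; rewrite -{1}[n]p'K (mem_image (can_inj pK)).
Qed.

(** * Counting the elements of a set *)

Definition count_below (S : set nat) n : nat :=
  \sum_(k < n) ((k : nat) \in S : nat).

Lemma count_below0 S : count_below S 0 = 0.
Proof. exact: big_ord0. Qed.

Lemma count_belowS S n : count_below S n.+1 = count_below S n + (n \in S).
Proof. by rewrite /count_below big_ord_recr. Qed.

Lemma count_below_homo S : {homo count_below S : m n / m <= n}.
Proof.
apply: homo_leq => [//|? ? ?|n]; first exact: leq_trans.
by rewrite count_belowS leq_addr.
Qed.

Lemma count_below_lt S m n :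
  m \in S -> m < n -> count_below S m < count_below S n.
Proof.
by move=> Sm /(count_below_homo S); rewrite count_belowS Sm addn1.
Qed.

Lemma count_below_split S T n :
  count_below T n = count_below (T `&` S) n + count_below (T `&` ~` S) n.
Proof.
rewrite /count_below -big_split; apply: eq_bigr => k _ /=.
by rewrite !in_setI in_setC; case: (_ \in T); case: (_ \in S).
Qed.

Lemma count_below_setC S n : count_below S n + count_below (~` S) n = n.
Proof.
elim: n => [|n IH]; first by rewrite !count_below0.
by rewrite !count_belowS in_setC; case: (n \in S) => /=; lia.
Qed.

Lemma count_below_le S n : count_below S n <= n.
Proof. by rewrite -{2}(count_below_setC S n) leq_addr. Qed.

Lemma count_below_subset S T n : S `<=` T -> count_below S n <= count_below T n.
Proof.
by move/setIidr => <-; rewrite [leqRHS](count_below_split S) leq_addr.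
Qed.

Lemma computable_count_below S : computable_set S -> computable (count_below S).
Proof.
move=> cS; apply: (@computable_prec 0 (fun k y => y + (k \in S))).
- apply: (recursive_comp2 computable2_add); first exact: recursive_nth.
  exact/(recursive_comp cS)/recursive_nth.
- exact: count_below0.
- exact: count_belowS.
Qed.

Lemma infinite_set_unbounded (S : set nat) N :
  infinite_set S -> exists2 n, n \in S & N <= n.
Proof.
move=> infS; apply: contrapT => /forall2NP bndS; apply: infS.
apply: sub_finite_set (finite_II N) => n Sn /=.
by rewrite ltnNge; apply/negP; case: (bndS n) => // -[]; exact: mem_set.
Qed.

Lemma cvg_count_below S :
  infinite_set S -> count_below S n @[n --> \oo] --> \oo.
Proof.
move=> infS; apply/cvgnyPge; elim=> [|m [N _ leN]]; first by near=> n.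
have [k Sk leNk] := infinite_set_unbounded N infS.
exists k.+1 => // n /= lt_kn.
exact: leq_ltn_trans (leN _ leNk) (count_below_lt Sk lt_kn).
Unshelve. all: by end_near. Qed.

Lemma count_below_bij S : infinite_set S -> set_bij S setT (count_below S).
Proof.
move=> infS; split=> // [m n Sm Sn eq_mn|m _].
  by case: (ltngtP m n) => // [/(count_below_lt Sm)|/(count_below_lt Sn)];
    rewrite eq_mn ltnn.
have ex_n : exists n, m < count_below S n.
  have [N _ ltN] := (cvgnyPgt _).1 (cvg_count_below infS) m.
  by exists N; exact: ltN (leqnn N).
case: (ex_minnP ex_n) => -[|n]; first by rewrite count_below0.
rewrite count_belowS => lt_m min_n.
have le_m : count_below S n <= m.
  by rewrite leqNgt; apply/negP => /min_n; rewrite ltnn.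
by exists n; move: lt_m; case: (boolP (n \in S)) => [/set_mem//|_] /=; lia.
Qed.

(** * Ranges and ranks *)

Lemma infinite_range (f : nat -> nat) : injective f -> infinite_set (range f).
Proof.
move=> inj_f.
have inj_fT : {in [set: nat] &, injective f} by move=> ? ? _ _ /inj_f.
by rewrite (eq_finite_set (inj_card_eq inj_fT)); exact: infinite_nat.
Qed.

Section StrictlyIncreasing.
Variable g : nat -> nat.
Hypothesis g_homo : {homo g : i j / i < j}.

Lemma ltn_count_below_range k n : (k < count_below (range g) n) = (g k < n).
Proof.
elim: n k => [|n IH] k; first by rewrite count_below0 !ltn0.
rewrite count_belowS.
case: (boolP (n \in range g)) => [/set_mem[i _ gi]|notin] /=.
  have le_i : count_below (range g) n <= i by rewrite leqNgt IH gi ltnn.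
  have ge_i : i <= count_below (range g) n.
    by case: i gi {le_i} => // i gi; rewrite IH -gi g_homo.
  by rewrite -[in RHS]gi [RHS]ltnS (leq_mono g_homo); lia.
rewrite addn0 IH [RHS]ltnS [RHS]leq_eqVlt; case: eqP => // gk.
by case/negP: notin; apply/mem_set; exists k.
Qed.

Lemma computable_set_range_homo : computable g -> computable_set (range g).
Proof.
move=> cg; have cc : computable (count_below (range g)).
  apply: (@computable_mu (fun k n => n - g k)) => [|n|n k].
  - apply: (recursive_comp2 computable2_sub); first exact: recursive_nth.
    exact/(recursive_comp cg)/recursive_nth.
  - by apply/eqP; rewrite subn_eq0 leqNgt -ltn_count_below_range ltnn.
  - by rewrite ltn_count_below_range subn_gt0.
rewrite /computable_set (_ : (fun n => _) =
    (fun n => count_below (range g) n.+1 - count_below (range g) n)).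
  apply: (computable_comp2 computable2_sub) => //.
  exact: computable_comp cc computable_succ.
by apply/funext => n; rewrite count_belowS addKn.
Qed.

End StrictlyIncreasing.

Definition squares : set nat := range (fun k => k * k).

Lemma square_homo : {homo (fun k => k * k) : i j / i < j}.
Proof. by move=> i j ij; rewrite ltn_mul. Qed.

Lemma count_below_squares n : count_below squares n ^ 2 <= 4 * n.
Proof.
case cE: (count_below _ n) => [//|c].
have : c * c < n by rewrite -(ltn_count_below_range square_homo) cE.
by nia.
Qed.

Lemma computable_squares : computable_set squares.
Proof.
apply: computable_set_range_homo; first exact: square_homo.
exact: computable_comp2 computable2_mul computable_id computable_id.
Qed.

Lemma infinite_squares : infinite_set squares.
Proof. exact/infinite_range/incn_inj/leq_mono/square_homo. Qed.

Lemma infinite_nonsquares : infinite_set (~` squares).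
Proof.
have inj_h : injective (fun k => k.+1 * k.+1 + 1) by move=> i j; nia.
apply: sub_infinite_set (infinite_range inj_h) => _ [k _ <-] [i _] /=.
by case: (leqP i k.+1) => ik; have := leq_mul ik ik; lia.
Qed.

Definition rank (f : nat -> nat) (n : nat) : nat := count_below (range f) (f n).

Lemma rank_bij f : injective f -> bijective (rank f).
Proof.
move=> inj_f; rewrite -setTT_bijective.
have count_bij := count_below_bij (infinite_range inj_f).
exact: set_bij_comp (set_bij_range inj_f) count_bij.
Qed.

Lemma computable_permutation_rank f : computable_injection f ->
  computable_set (range f) -> computable_permutation (rank f).
Proof.
move=> [cf inj_f] crange; split; last exact: rank_bij.
exact: computable_comp (computable_count_below crange) cf.
Qed.

Lemma count_below_rank f T n : injective f ->
  count_below (T `&` range f) n =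
  count_below (rank f @` (f @^-1` T)) (count_below (range f) n).
Proof.
move=> inj_f; elim: n => [|n IH]; first by rewrite !count_below0.
rewrite !count_belowS IH in_setI.
case: (boolP (n \in range f)) => [/set_mem[i _ <-]|_]; last first.
  by rewrite andbF !addn0.
rewrite andbT addn1 count_belowS -/(rank f i).
by rewrite mem_image//; exact/bij_inj/rank_bij.
Qed.

(* The inverse of [p] is the easy one to write down: it sends the [k]-th
   element of [S] to [f (q^-1 k)] and the [k]-th element of the complement
   to [g k]. *)
Lemma exists_permutation_rank f g q S :
  computable_injection f -> computable_injection g -> range g = ~` range f ->
  computable_permutation q ->
  computable_set S -> infinite_set S -> infinite_set (~` S) ->
  exists p,
    [/\ computable_permutation p, range (p \o f) = S & rank (p \o f) = q].
Proof.
move=> [cf inj_f] [cg inj_g] fgC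
  /computable_permutation_inverse[q' [[cq' bij_q'] qK q'K]].
move=> cS infS infSC.
pose s y :=
  if y \in S then f (q' (count_below S y)) else g (count_below (~` S) y).
have bij_fq' : set_bij setT (range f) (f \o q').
  apply: (set_bij_comp _ (set_bij_range inj_f)).
  by rewrite setTT_bijective.
have bij_s : bijective s.
  apply: (@set_bij_glue _ _ S (range f)).
    exact: (set_bij_comp (count_below_bij infS) bij_fq').
  rewrite -fgC.
  exact: (set_bij_comp (count_below_bij infSC) (set_bij_range inj_g)).
have cs : computable s.
  apply: (computable_if cS).
    exact/(computable_comp cf)/(computable_comp cq')/computable_count_below.
  exact/(computable_comp cg)/computable_count_below/computable_setC.
have [p [cp sK pK]] := computable_permutation_inverse (conj cs bij_s).
have mem_pf n : p (f n) \in S.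
  apply: contraT => notS; have : (~` range f) (f n).
    rewrite -fgC; exists (count_below (~` S) (p (f n))) => //.
    by rewrite -[RHS]pK /s (negbTE notS).
  by case; exists n.
have range_pf : range (p \o f) = S.
  apply/seteqP; split=> [_ [n _ <-]|y Sy]; first exact/set_mem/mem_pf.
  by exists (q' (count_below S y)) => //=; rewrite -[RHS]sK /s mem_set.
exists p; split=> //; apply/funext => n; rewrite /rank range_pf /=.
by apply: (can_inj q'K); apply: inj_f; rewrite qK -[RHS]pK /s mem_pf.
Qed.

(** * Relative density *)

Section RelativeDensity.
Local Open Scope ring_scope.
Variable R : realType.
Implicit Types (S T : set nat) (r : R) (f : nat -> nat).

Definition relative_partial_density T S n : R :=
  (count_below (T `&` S) n)%:R / (count_below S n)%:R.

Definition has_relative_density T S r : Prop :=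
  relative_partial_density T S n @[n --> \oo] --> r.

Lemma partial_densityE S n :
  partial_density R S n = (count_below S n)%:R / n%:R.
Proof.
congr (_%:R / _); rewrite -sum1dep_card /count_below big_mkcond /=.
by apply: eq_bigr => k _; case: (_ \in S).
Qed.

Lemma partial_density_ge0 S n : 0 <= partial_density R S n.
Proof. by rewrite partial_densityE divr_ge0. Qed.

Lemma partial_density_subset S T n :
  S `<=` T -> partial_density R S n <= partial_density R T n.
Proof.
move=> ST; rewrite !partial_densityE ler_wpM2r ?invr_ge0// ler_nat.
exact: count_below_subset.
Qed.

Lemma partial_density_split S T n : partial_density R T n =
  partial_density R (T `&` S) n + partial_density R (T `&` ~` S) n.
Proof. by rewrite !partial_densityE (count_below_split S) natrD mulrDl. Qed.

Lemma partial_density_setC S n : (0 < n)%N ->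
  partial_density R S n + partial_density R (~` S) n = 1.
Proof.
move=> n0; rewrite !partial_densityE -mulrDl -natrD count_below_setC divff//.
by rewrite pnatr_eq0 -lt0n.
Qed.

Lemma relative_partial_densityK T S n :
  relative_partial_density T S n * partial_density R S n =
  partial_density R (T `&` S) n.
Proof.
rewrite !partial_densityE mulrA; congr (_ / _).
have [S0|S0] := eqVneq (count_below S n) 0%N; last by rewrite divfK// pnatr_eq0.
suff -> : count_below (T `&` S) n = 0%N by rewrite S0 mulr0.
by apply/eqP; rewrite -leqn0 -S0 count_below_subset//; exact: subIsetr.
Qed.

Lemma has_density_setC S r : has_density S r -> has_density (~` S) (1 - r).
Proof.
move=> dS; have : (1 - partial_density R S n) @[n --> \oo] --> 1 - r.
  by apply: cvgB dS; exact: cvg_cst.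
apply: cvg_trans; apply: near_eq_cvg; near=> n.
have n0 : (0 < n)%N by near: n; exact: nbhs_infty_gt.
by rewrite /= -(partial_density_setC S n0) addrAC subrr add0r.
Unshelve. all: by end_near. Qed.

(* The density of [T] is a convex combination of its relative densities. *)
Lemma has_density_glue T S r :
  has_relative_density T S r -> has_relative_density T (~` S) r ->
  has_density T r.
Proof.
move=> /cvgr_dist_le dS /cvgr_dist_le dSC; apply/cvgrPdist_le => e e0.
near=> n.
have leS : `|r - relative_partial_density T S n| <= e by near: n; exact: dS.
have leSC : `|r - relative_partial_density T (~` S) n| <= e.
  by near: n; exact: dSC.
have setC1 : partial_density R S n + partial_density R (~` S) n = 1.
  by apply: partial_density_setC; near: n; exact: nbhs_infty_gt.
rewrite (partial_density_split S) -!relative_partial_densityK.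
rewrite -{1}[r]mulr1 -setC1 mulrDr opprD addrACA -!mulrBl.
rewrite -[leRHS]mulr1 -setC1 [leRHS]mulrDr.
rewrite (le_trans (ler_normD _ _))// !(normrM (r - _)).
rewrite !(ger0_norm (partial_density_ge0 _ _)).
by rewrite lerD// ler_wpM2r// partial_density_ge0.
Unshelve. all: by end_near. Qed.

Lemma has_density1_relative T S r :
  has_density S (1 : R) -> has_density T r -> has_relative_density T S r.
Proof.
move=> dS dT.
have dTC : has_density (T `&` ~` S) (0 : R).
  have dSC := has_density_setC dS; rewrite subrr in dSC.
  apply: squeeze_cvgr (cvg_cst 0) dSC; near=> n.
  by rewrite partial_density_ge0 partial_density_subset//; exact: subIsetr.
have dTS : has_density (T `&` S) r.
  have : (partial_density R T n - partial_density R (T `&` ~` S) n)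
      @[n --> \oo] --> r - 0.
    exact: cvgB.
  rewrite subr0; apply: cvg_trans; apply: near_eq_cvg; near=> n.
  by rewrite /= (partial_density_split S T) addrK.
have : (partial_density R (T `&` S) n / partial_density R S n)
    @[n --> \oo] --> r / 1.
  by apply: cvgM => //; apply: cvgV => //; exact: oner_neq0.
rewrite divr1; apply: cvg_trans; apply: near_eq_cvg; near=> n => /=.
rewrite -relative_partial_densityK mulfK//; near: n.
exact: cvgr_neq0 dS (oner_neq0 R).
Unshelve. all: by end_near. Qed.

Lemma has_relative_density_rank f T r : injective f ->
  has_relative_density T (range f) r <-> has_density (rank f @` (f @^-1` T)) r.
Proof.
move=> inj_f; have infR := infinite_range inj_f.
have relE : relative_partial_density T (range f) =
    partial_density R (rank f @` (f @^-1` T)) \o count_below (range f).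
  by apply/funext => n /=; rewrite partial_densityE -count_below_rank.
split; last first.
  by rewrite /has_relative_density relE; exact: cvg_comp (cvg_count_below infR).
have count_surj m : exists n, count_below (range f) n = m.
  by have [_ _ /(_ m I)[n _ <-]] := count_below_bij infR; exists n.
have [h countK] := choice count_surj.
have cvg_h : h m @[m --> \oo] --> \oo.
  apply/cvgnyPge => N; near=> m.
  apply: leq_trans (count_below_le (range f) (h m)).
  by rewrite countK; near: m; exact: nbhs_infty_ge.
move=> /(cvg_comp _ _ cvg_h); rewrite relE /has_density.
by apply: cvg_trans; apply: near_eq_cvg; near=> m; rewrite /= countK.
Unshelve. all: by end_near. Qed.

Lemma has_density_squares : has_density squares (0 : R).
Proof.
apply/cvgrPdist_le => e e0; near=> n.
rewrite sub0r normrN ger0_norm ?partial_density_ge0// partial_densityE.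
have n0 : 0 < n%:R :> R by rewrite ltr0n; near: n; exact: nbhs_infty_gt.
have le4 : 4 / e ^+ 2 <= n%:R by near: n; exact: nbhs_infty_ger.
rewrite ler_pdivrMr// -ler_sqr ?nnegrE ?mulr_ge0 ?(ltW e0) ?(ltW n0)//.
rewrite -natrX; apply: (@le_trans _ _ (4 * n)%:R).
  by rewrite ler_nat count_below_squares.
rewrite exprMn [n%:R ^+ 2]expr2 mulrA natrM ler_wpM2r// mulrC.
by rewrite -ler_pdivrMr// exprn_gt0.
Unshelve. all: by end_near. Qed.

Lemma has_density_nonsquares : has_density (~` squares) (1 : R).
Proof. by rewrite -[1]subr0; exact: has_density_setC has_density_squares. Qed.

End RelativeDensity.

(** * Intrinsic density *)

Section IntrinsicDensity.
Variables (R : realType) (r : R).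

Lemma has_intrinsic_density_relative f C :
  computable_injection f -> computable_set (range f) ->
  has_intrinsic_density (f @^-1` C) r -> has_relative_density C (range f) r.
Proof.
move=> cf crange dC; apply/(has_relative_density_rank _ _ cf.2)/dC.
exact: computable_permutation_rank.
Qed.

Lemma has_intrinsic_density_preimage f g C :
  computable_injection f -> computable_injection g -> range g = ~` range f ->
  has_intrinsic_density C r -> has_intrinsic_density (f @^-1` C) r.
Proof.
move=> cf cg fgC dC q cq.
have infSC : infinite_set (~` ~` squares).
  by rewrite setCK; exact: infinite_squares.
have [p [cp range_pf rank_pf]] := exists_permutation_rank cf cg fgC cq
  (computable_setC computable_squares) infinite_nonsquares infSC.
have inj_p := bij_inj cp.2.
rewrite -rank_pf -(image_comp_preimage f C inj_p).
apply/has_relative_density_rank; first exact: inj_comp inj_p cf.2.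
rewrite range_pf.
exact: has_density1_relative (@has_density_nonsquares R) (dC p cp).
Qed.

Lemma has_intrinsic_density_glue f g C :
  computable_injection f -> computable_injection g ->
  range g = ~` range f -> computable_set (range f) ->
  has_intrinsic_density (f @^-1` C) r -> has_intrinsic_density (g @^-1` C) r ->
  has_intrinsic_density C r.
Proof.
move=> cf cg fgC crange dfC dgC p cp; have inj_p := bij_inj cp.2.
have relative h : computable_injection h -> computable_set (range h) ->
    has_intrinsic_density (h @^-1` C) r ->
    has_relative_density (p @` C) (range (p \o h)) r.
  move=> [ch inj_h] cS dhC; apply: has_intrinsic_density_relative.
  - by split; [exact: computable_comp cp.1 ch|exact: inj_comp].
  - by rewrite -(image_comp h p); exact: computable_set_image cp cS.
  - by rewrite image_comp_preimage.
apply: (has_density_glue (relative _ cf crange dfC)).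
have -> : ~` range (p \o f) = range (p \o g).
  rewrite -(image_comp f p) -(image_comp g p) fgC.
  by rewrite image_setC_bij//; exact: cp.2.
by apply: relative => //; rewrite fgC; exact: computable_setC.
Qed.

Lemma has_intrinsic_density_split f g C :
  computable_injection f -> computable_injection g ->
  range g = ~` range f -> computable_set (range f) ->
  has_intrinsic_density C r <->
  has_intrinsic_density (f @^-1` C) r /\ has_intrinsic_density (g @^-1` C) r.
Proof.
move=> cf cg fgC crange; split; last first.
  by case; exact: has_intrinsic_density_glue cf cg fgC crange.
have gfC : range f = ~` range g by rewrite fgC setCK.
move=> dC; split; first exact: has_intrinsic_density_preimage cf cg fgC dC.
exact: has_intrinsic_density_preimage cg cf gfC dC.
Qed.

End IntrinsicDensity.

Lemma preimage_set_oplus_even A B : muln 2 @^-1` set_oplus A B = A.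
Proof.
apply/seteqP; split=> [n [[m Am] /eqP|[m _]]|n An]; last by left; exists n.
- by rewrite eqn_mul2l => /eqP <-.
- by lia.
Qed.

Lemma preimage_set_oplus_odd A B : (fun n => 2 * n + 1) @^-1` set_oplus A B = B.
Proof.
apply/seteqP; split=> [n [[m _]|[m Bm] /eqP]|n Bn]; last by right; exists n.
- by lia.
- by rewrite eqn_add2r eqn_mul2l => /eqP <-.
Qed.

Lemma range_odd : range (fun n => 2 * n + 1) = ~` range (muln 2).
Proof.
apply/seteqP; split=> [_ [n _ <-] [m _]|n Nn]; first by lia.
exists n./2 => //; case: (boolP (odd n)) => [|even_n]; first by lia.
by case: Nn; exists n./2 => //; lia.
Qed.

Lemma computable_injection_even : computable_injection (muln 2).
Proof.
split; last by move=> m n; lia.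
exact: computable_comp2 computable2_mul (computable_const 2) computable_id.
Qed.

Lemma computable_injection_odd : computable_injection (fun n => 2 * n + 1).
Proof.
split; last by move=> m n; lia.
exact: computable_comp2 computable2_add computable_injection_even.1
  (computable_const 1).
Qed.

Lemma computable_evens : computable_set (range (muln 2)).
Proof.
by apply: computable_set_range_homo computable_injection_even.1 => m n; lia.
Qed.

Theorem theorem2p1 (R : realType) (r : R) (A B : set nat) :
  has_intrinsic_density (set_oplus A B) r <->
  has_intrinsic_density A r /\ has_intrinsic_density B r.
Proof.
have := has_intrinsic_density_split r (set_oplus A B)
  computable_injection_even computable_injection_odd range_odd computable_evens.
by rewrite preimage_set_oplus_even preimage_set_oplus_odd.
Qed.
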